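(* Let $0\le\alpha<n$, $0<\delta<\min\{\gamma,(n-\alpha)/m\}$ and $\tilde\alpha=m\delta+\alpha$. Then there exist non-trivial pairs of weights $(v,w)$ satisfying the condition $\mathbb{H}(r,\tilde\alpha,\tilde\delta)$ for every $r$ and $\tilde\delta$ in the range $$1\le r\le\infty\qquad\text{and}\qquad\tilde\alpha-n\le\tilde\delta\le\min\{\delta,\tilde\alpha-n/r\},$$ excluding the case $\tilde\delta=\delta$ when $\tilde\alpha-n/r=\delta$. (The pair may depend on $r$ and $\tilde\delta$.)
   Context: Here $n\ge1$, $m\in\mathbb{N}\cup\{0\}$, $0<\gamma\le1$ is a fixed number, $(n-\alpha)/m=\infty$ if $m=0$, $n/r=0$ if $r=\infty$, and $r'$ is the conjugate exponent of $r$. Weights are nonnegative locally integrable functions on $\mathbb{R}^n$. A pair $(v,w)$ is trivial if $v=0$ a.e. or $w=\infty$ a.e., and non-trivial otherwise. For $1<r\le\infty$, a pair of weights $(v,w)$ belongs to $\mathbb{H}(r,\tilde\alpha,\tilde\delta)$ (a class that also depends on $\delta$) if $$\sup_B\|(1/w)\chi_B\|_{\infty}|B|^{\frac{\delta-\tilde\delta}{n}}\left(\int_{\mathbb{R}^n}\frac{v^{r'}(y)}{\left(|B|^{1/n}+|x_B-y|\right)^{r'(n-\tilde\alpha+\delta)}}\,dy\right)^{1/r'}<\infty,$$ the supremum being over all balls $B$, with center $x_B$. For $r=1$, the factor $(\int\cdots)^{1/r'}$ is replaced by $\left\|v(\cdot)\left(|B|^{1/n}+|x_B-\cdot|\right)^{-(n-\tilde\alpha+\delta)}\right\|_\infty$.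 *)

(* Defs.v *)
From HB Require Import structures.
From mathcomp Require Import all_boot all_order all_algebra.
From mathcomp Require Import all_classical all_reals all_analysis.
From mathcomp Require Import measurable_realfun.

Set Implicit Arguments.
Unset Strict Implicit.
Unset Printing Implicit Defensive.
Import Order.TTheory GRing.Theory Num.Theory.
Import numFieldNormedType.Exports.

Local Open Scope classical_set_scope.
Local Open Scope ring_scope.

(* R^n is the tuple type with its product (Borel) sigma-algebra: the library has
   no measurable structure on 'rV[R]_n, and its norm there is the sup norm. *)
Notation euclid R n := (n.-tuple (measurableTypeR R)).

Definition cons_pair (R : realType) (n : nat)
    (p : measurableTypeR R * euclid R n) : euclid R n.+1 :=
  [the n.+1.-tuple _ of p.1 :: p.2].

Lemma measurable_cons_pair (R : realType) (n : nat) :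
  measurable_fun [set: measurableTypeR R * euclid R n] (@cons_pair R n).
Proof. by apply: measurable_cons. Qed.

Section lebesgue_succ.
Local Open Scope ereal_scope.
Context {R : realType} {n : nat}.
Variable mu : {sigma_finite_measure set (euclid R n) -> \bar R}.

Definition lebesgue_succ : set (euclid R n.+1) -> \bar R :=
  pushforward (@lebesgue_measure R \x mu) (@cons_pair R n).

Let lebesgue_succ0 : lebesgue_succ set0 = 0.
Proof. by rewrite /lebesgue_succ /pushforward preimage_set0 measure0. Qed.

Let lebesgue_succ_ge0 A : 0 <= lebesgue_succ A.
Proof. by rewrite /lebesgue_succ /pushforward measure_ge0. Qed.

Let lebesgue_succ_sigma_additive : semi_sigma_additive lebesgue_succ.
Proof.
exact: (@measure_semi_sigma_additive _ _ _
  (measure_function_pushforward__canonical__measure_function_Measure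
    (@lebesgue_measure R \x mu) (@measurable_cons_pair R n))).
Qed.

HB.instance Definition _ := isMeasure.Build _ _ _ lebesgue_succ
  lebesgue_succ0 lebesgue_succ_ge0 lebesgue_succ_sigma_additive.

Let lebesgue_succ_sigma_finite : sigma_finite setT lebesgue_succ.
Proof.
have /sigma_finiteP[F [TF ndF Foo]] := sigma_finiteT (@lebesgue_measure R).
have /sigma_finiteP[G [TG ndG Goo]] := sigma_finiteT mu.
pose dec (x : euclid R n.+1) : measurableTypeR R * euclid R n :=
  (thead x, [tuple of behead x]).
have decK p : dec (cons_pair p) = p.
  by case: p => a x; rewrite /dec /cons_pair theadE; congr pair; exact/val_inj.
have mdec : measurable_fun setT dec.
  by apply/measurable_fun_pair => /=;
    [exact: (measurable_tnth ord0)|exact: measurable_behead].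
exists (fun i => dec @^-1` (F i `*` G i)).
  rewrite -preimage_bigcup -(preimage_setT dec); congr (_ @^-1` _).
  rewrite -setXTT TF TG; apply/seteqP; split=> -[x y] /=.
    move=> [[i _ Fix] [j _ Gjy]]; exists (maxn i j) => //; split => /=.
      by move: x Fix; exact/subsetPset/ndF/leq_maxl.
    by move: y Gjy; exact/subsetPset/ndG/leq_maxr.
  by move=> [i _ []/= ? ?]; split; exists i.
move=> i; have [mF Fi] := Foo i; have [mG Gi] := Goo i; split.
  by rewrite -[X in measurable X]setTI; apply: mdec => //; exact: measurableX.
rewrite /lebesgue_succ /pushforward -comp_preimage.
rewrite (_ : dec \o _ = id); last by apply/funext => p; exact: decK.
by rewrite product_measure1E// lte_mul_pinfty// ge0_fin_numE.
Qed.

HB.instance Definition _ := Measure_isSigmaFinite.Build _ _ _ lebesgue_succ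
  lebesgue_succ_sigma_finite.

End lebesgue_succ.

(* n-dimensional Lebesgue measure: the n-fold product of the one-dimensional one,
   transported from R * R^n to R^(n+1) along cons_pair. *)
Fixpoint lebesgue_measure_n (R : realType) (n : nat) :
    {sigma_finite_measure set (euclid R n) -> \bar R} :=
  match n with
  | 0 => dirac ([tuple] : euclid R 0)
  | n'.+1 => lebesgue_succ (lebesgue_measure_n R n')
  end.

Section weights.
Context {R : realType} {n : nat}.
Local Notation Rn := (euclid R n).
Local Notation mu := (lebesgue_measure_n R n).

Definition euclid_dist (x y : Rn) : R :=
  Num.sqrt (\sum_(i < n) ((tnth x i : R) - (tnth y i : R)) ^+ 2).

Definition euclid_ball (x : Rn) (rho : R) : set Rn :=
  [set y | euclid_dist x y < rho].

Local Open Scope ereal_scope.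

(* Measurability is Lebesgue measurability: mu lives on the Borel sets, and the
   Lebesgue measurable functions are those equal a.e. to a Borel one. Weights
   are \bar R-valued, as triviality of a pair mentions w = +oo. *)
Definition weight (w : Rn -> \bar R) : Prop :=
  [/\ forall x, 0 <= w x,
      exists2 g : Rn -> \bar R, measurable_fun setT g & w = g %[ae mu]
    & forall x rho, \int[mu]_(y in euclid_ball x rho) w y < +oo].

Definition trivial_pair (v w : Rn -> \bar R) : Prop :=
  v = cst 0 %[ae mu] \/ w = cst +oo %[ae mu].

(* |B|^{1/n} for the ball B of center x and radius rho *)
Definition ball_size (x : Rn) (rho : R) : R :=
  (fine (mu (euclid_ball x rho)) `^ (n%:R^-1))%R.

(* The integral factor of the condition; for r = 1 it is the L^oo norm. *)
Definition bbH_tail (r : \bar R) (delta talpha : R) (v : Rn -> \bar R)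
    (x : Rn) (rho : R) : \bar R :=
  let s := (n%:R - talpha + delta)%R in
  let d y := (ball_size x rho + euclid_dist x y)%R in
  if r == 1 then
    Lnorm mu +oo (fun y => v y * (d y `^ (- s))%:E)
  else
    let r' := fine (hoelder_conjugate r) in
    (\int[mu]_y (v y `^ r' / (d y `^ (r' * s))%:E)) `^ r'^-1.

(* Inversion in \bar R: 0^-1 = +oo and +oo^-1 = 0. *)
Definition bbH_quantity (r : \bar R) (delta talpha tdelta : R)
    (v w : Rn -> \bar R) (x : Rn) (rho : R) : \bar R :=
  Lnorm mu +oo (fun y => (w y)^-1 * (\1_(euclid_ball x rho) y)%:E)
  * (fine (mu (euclid_ball x rho)) `^ ((delta - tdelta) / n%:R))%:E
  * bbH_tail r delta talpha v x rho.

Definition bbH (r : \bar R) (delta talpha tdelta : R)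
    (v w : Rn -> \bar R) : Prop :=
  ereal_sup [set z | exists (x : Rn) (rho : R), (0 < rho)%R /\
    z = bbH_quantity r delta talpha tdelta v w x rho] < +oo.

End weights.

(* Main.v *)
(* Take w = 1 and for v the indicator of a unit cube. With e = |B|^{1/n}, the
   quantity to bound is the r'-th root of the integral over the cube of
   e^q (e + |x - y|)^{-p}, where q = r'(delta - tdelta) and
   p = r'(n - talpha + delta). The lower bound on tdelta gives q <= p, so the
   kernel is at most 1 once e + |x - y| >= 1. Otherwise each e + |x_i - y_i| is
   at most e + |x - y| < 1, so the kernel is dominated by the product over i of
   the one-dimensional kernels e^{q/n} (e + |x_i - y_i|)^{-c} for any c >= p/n,
   and Tonelli reduces everything to one variable. The upper bounds on tdelta
   give p - q <= n, so c = 1 + q/n is allowed if q > 0; if q = 0, the excluded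
   case is what makes c = p/n < 1. In both cases the one-dimensional integral is
   bounded uniformly in e <= 1. For r = 1 the range forces
   delta - tdelta = n - talpha + delta and the bound is pointwise. *)
Require Import Defs.
From HB Require Import structures.
From mathcomp Require Import all_boot all_order all_algebra.
From mathcomp Require Import all_classical all_reals all_analysis.
From mathcomp Require Import measurable_realfun ess_sup_inf ring lra.
Import Order.TTheory GRing.Theory Num.Theory.
Import numFieldNormedType.Exports.
Local Open Scope classical_set_scope.
Local Open Scope ring_scope.

(** * Tonelli for products of one-variable functions *)

Section product_integral.
Context {R : realType}.
Local Open Scope ereal_scope.

(** Induction on the dimension: Tonelli along [cons_pair] splits off the first coordinate, and the
    inner integral over the others is a constant by induction. The one-dimensional integrals are
    required to be finite so that their product is taken in [R]. *)
Lemma integral_prod_tnth (n : nat) (f : 'I_n -> R -> R) (k : 'I_n -> R) :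
    (forall i, measurable_fun setT (f i)) -> (forall i t, (0 <= f i t)%R) ->
    (forall i, \int[@lebesgue_measure R]_t (f i t)%:E = (k i)%:E) ->
  \int[lebesgue_measure_n R n]_y (\prod_(i < n) f i (tnth y i))%:E =
    (\prod_(i < n) k i)%:E.
Proof.
elim: n f k => [|n IH] f k mf f0 fk.
  under eq_integral => y _ do rewrite big_ord0.
  by rewrite big_ord0 (integral_dirac _ measurableT) ?diracT ?mul1e//.
have mprod m (g : 'I_m -> R -> R) : (forall i, measurable_fun setT (g i)) ->
    measurable_fun setT (fun y : euclid R m => (\prod_(i < m) g i (tnth y i))%:E).
  move=> mg; apply/measurable_EFinP; apply: measurable_prod => i _.
  by apply: (measurableT_comp (mg i)); exact: measurable_tnth.
have prod0 m (g : 'I_m -> R -> R) (y : euclid R m) : (forall i t, (0 <= g i t)%R) ->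
    0 <= (\prod_(i < m) g i (tnth y i))%:E.
  by move=> g0; rewrite lee_fin prodr_ge0.
(* The measure in dimension n+1 is this pushforward by conversion. *)
transitivity (\int[pushforward (lebesgue_measure \x lebesgue_measure_n R n)
    (@cons_pair R n)]_y (\prod_(i < n.+1) f i (tnth y i))%:E); first by [].
rewrite ge0_integral_pushforward//; last 3 first.
- exact: measurable_cons_pair.
- exact: mprod.
- by move=> y _; exact: prod0.
rewrite preimage_setT fubini_tonelli1//; last 2 first.
- apply: (measurableT_comp (mprod _ _ mf)); exact: measurable_cons_pair.
- by move=> p; exact: prod0.
transitivity (\int[@lebesgue_measure R]_t ((f ord0 t)%:E *
    (\prod_(i < n) k (lift ord0 i))%:E)).
  apply: eq_integral => t _; rewrite /fubini_F /=.
  rewrite -(IH (fun i => f (lift ord0 i)))//.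
  rewrite -ge0_integralZl ?lee_fin//; last 2 first.
  - by apply: (mprod n (fun i => f (lift ord0 i))) => i; exact: mf.
  - by move=> y _; apply: (prod0 n (fun i => f (lift ord0 i))) => i; exact: f0.
  apply: eq_integral => y _; rewrite big_ord_recl tnth0 EFinM.
  by under eq_bigr => i _ do rewrite tnthS.
rewrite ge0_integralZr//; last 3 first.
- by apply/measurable_EFinP; exact: mf.
- by move=> t _; rewrite lee_fin.
- rewrite lee_fin; apply: prodr_ge0 => i _.
  by rewrite -lee_fin -fk; apply: integral_ge0 => t _; rewrite lee_fin.
by rewrite fk big_ord_recl EFinM.
Qed.

End product_integral.

(** * One-dimensional power integrals, uniformly in the shift e *)

Section power_integral.
Context {R : realType}.
Local Notation lambda := (@lebesgue_measure R).

Lemma continuous_is_derive (f : R -> R) (df t : R) :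
  is_derive t 1 f df -> {for t, continuous f}.
Proof.
by move=> [dft _]; apply: differentiable_continuous; exact/derivable1_diffP.
Qed.

Lemma is_derive_powR_shift (b : R) {e x t : R} : 0 < e + (t - x) ->
  is_derive t 1 (fun t => (e + (t - x)) `^ b) (b * (e + (t - x)) `^ (b - 1)).
Proof.
move=> t0; have dpow := is_derive1_powR b t0.
have dlin : is_derive t 1 (fun t : R => e + (t - x)) (0 + (1 + 0)).
  by apply: is_deriveD; apply: is_deriveB.
rewrite (_ : (fun t => _) = (@powR R ^~ b) \o (fun t : R => e + (t - x)))//.
by apply: is_derive_eq; rewrite addr0 add0r mulr1.
Qed.

(** Fundamental theorem of calculus; e > 0 keeps the base positive, so the integrand is continuous
    up to the endpoint t = x. *)
Lemma integral_powR_right (e c x : R) : 0 < e -> c != 1 ->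
  (\int[lambda]_(t in `[x, (x + 1)%R]) ((e + (t - x)) `^ (- c))%:E =
    (((e + 1) `^ (1 - c) - e `^ (1 - c)) / (1 - c))%:E)%E.
Proof.
move=> e0 c1.
have c10 : 1 - c != 0 by rewrite subr_eq0 eq_sym.
pose F (t : R) : R := (1 - c)^-1 * (e + (t - x)) `^ (1 - c).
have dF (t : R) : 0 < e + (t - x) -> is_derive t 1 F ((e + (t - x)) `^ (- c)).
  move=> /(is_derive_powR_shift (1 - c))/(is_deriveZ (1 - c)^-1) dFt.
  apply: is_derive_eq.
  by rewrite /GRing.scale/= mulrA mulVf// mul1r; congr (_ `^ _); rewrite addrC addKr.
have pos t : x <= t -> 0 < e + (t - x) by move=> xt; rewrite ltr_wpDr// subr_ge0.
have x1 : x < x + 1 by rewrite ltrDl.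
rewrite (@continuous_FTC2 _ _ F)//.
- rewrite /F subrr addr0 (addrC x) addrK -EFinB -mulrBr; congr (_%:E); exact: mulrC.
- apply: continuous_in_subspaceT => t; rewrite inE/= in_itv/= => /andP[xt _].
  exact: continuous_is_derive (is_derive_powR_shift (- c) (pos t xt)).
- split.
  + by move=> t; rewrite in_itv/= => /andP[/ltW/pos/dF[]].
  + by apply: cvg_at_right_filter; exact: continuous_is_derive (dF _ (pos _ _)).
  + by apply: cvg_at_left_filter; exact: continuous_is_derive (dF _ (pos _ (ltW x1))).
- move=> t; rewrite in_itv/= => /andP[/ltW/pos/dF[_ dFt] _].
  by rewrite derive1E.
Qed.

(** The reflection t -> -t carries this to [integral_powR_right] at -x. *)
Lemma integral_powR_left (e c x : R) : 0 < e -> c != 1 ->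
  (\int[lambda]_(t in `[(x - 1)%R, x]) ((e + (x - t)) `^ (- c))%:E =
    (((e + 1) `^ (1 - c) - e `^ (1 - c)) / (1 - c))%:E)%E.
Proof.
move=> e0 c1; rewrite -(integral_powR_right e c (- x))//.
have := @integration_by_substitution_oppr R (fun t => (e + (x - t)) `^ (- c)) (- x) (- x + 1).
rewrite opprD !opprK => ->; first by apply: eq_integral => t _ /=; rewrite !opprK (addrC t).
  by rewrite lerDl.
apply: continuous_in_subspaceT => t; rewrite inE/= in_itv/= => /andP[_ tx].
have Nt : 0 < e + (- t - - x) by rewrite ltr_wpDr// opprK addrC subr_ge0.
rewrite (_ : (fun t => _) =
    (fun t : R => (e + (t - - x)) `^ (- c)) \o -%R); last first.
  by apply/funext => s /=; rewrite opprK addrC (addrC (- s)) addrC.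
apply: continuous_comp; first exact: oppr_continuous.
exact: continuous_is_derive (is_derive_powR_shift _ Nt).
Qed.

(** In the first alternative the integral may grow like e^(-a) as e tends to 0, which the factor e^a
    compensates; in the second the singularity is integrable at e = 0. *)
Lemma integral_powR_le (a c : R) : (0 < a /\ c = 1 + a) \/ (a = 0 /\ c < 1) ->
  exists2 K : R, 0 <= K & forall e x : R, 0 < e <= 1 ->
  (\int[lambda]_(t in `[(x - 1)%R, (x + 1)%R])
     (e `^ a * (e + `|x - t|) `^ (- c))%:E <= K%:E)%E.
Proof.
move=> ac.
have c1 : c != 1.
  case: ac => [[a0 ->]|[_ c1]]; last by rewrite lt_eqF.
  by rewrite -subr_eq0 addrAC subrr add0r gt_eqF.
have [K K0 HK] : exists2 K : R, 0 <= K & forall e, 0 < e <= 1 ->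
    e `^ a * (((e + 1) `^ (1 - c) - e `^ (1 - c)) / (1 - c)) <= K.
  case: ac => [[a0 ->]|[-> c1']].
    (* The integral is (e^(-a) - (e+1)^(-a))/a; after multiplication by e^a, the first term gives
       1/a and the second is dropped. *)
    exists a^-1 => [|e /andP[e0 e1]]; first by rewrite invr_ge0 ltW.
    have -> : 1 - (1 + a) = - a by ring.
    have eaN : e `^ a * e `^ (- a) = 1.
      by rewrite powRN divff// gt_eqF// powR_gt0.
    rewrite invrN mulrN -mulNr opprB mulrA ler_pdivrMr// mulVf ?gt_eqF//.
    by rewrite mulrBr eaN gerBl mulr_ge0// powR_ge0.
  (* Drop the negative term and use e + 1 <= 2. *)
  exists (2 `^ (1 - c) / (1 - c)) => [|e /andP[e0 e1]].
    by rewrite divr_ge0 ?powR_ge0// subr_ge0 ltW.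
  rewrite powRr0 mul1r ler_pM2r ?invr_gt0 ?subr_gt0//.
  rewrite (@le_trans _ _ ((e + 1) `^ (1 - c)))// ?gerBl ?powR_ge0//.
  rewrite ge0_ler_powR ?nnegrE//; [lra|lra|lra].
(* One K for each side of x, where the absolute value has a fixed sign. *)
exists (K + K) => [|e x e01]; first exact: addr_ge0.
have e0 : 0 < e by case/andP: e01.
have mk : measurable_fun [set: R] (fun t : R => (e + `|x - t|) `^ (- c)).
  apply: (measurableT_comp (measurable_powR _)).
  apply: measurable_funD => //; apply: measurableT_comp => //.
  exact: measurable_funB.
have me : measurable_fun [set: R] (fun t : R => (e `^ a * (e + `|x - t|) `^ (- c))%:E).
  by apply/measurable_EFinP; exact: measurable_funM.
have p0 t : (0 <= (e `^ a * (e + `|x - t|) `^ (- c))%:E)%E.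
  by rewrite lee_fin mulr_ge0 ?powR_ge0.
have xx : `[x - 1, x + 1]%classic = `[x - 1, x] `|` `]x, x + 1] :> set R.
  by rewrite -itv_bndbnd_setU// bnd_simp; lra.
rewrite xx ge0_integral_setU//; last 2 first.
- exact: measurable_funTS.
- apply/disj_setPS => t [] /=; rewrite !in_itv/= => /andP[_ tx] /andP[xt _].
  by rewrite ltNge tx in xt.
rewrite integral_itv_obnd_cbnd; last exact: measurable_funTS.
have half (i : interval R) (f : R -> R) :
    {in i, forall t, f t = `|x - t|} ->
    (\int[lambda]_(t in [set` i]) ((e + f t) `^ (- c))%:E =
      (((e + 1) `^ (1 - c) - e `^ (1 - c)) / (1 - c))%:E)%E ->
    (\int[lambda]_(t in [set` i]) (e `^ a * (e + `|x - t|) `^ (- c))%:E <= K%:E)%E.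
  move=> fE int_f; under eq_integral => t _ do rewrite EFinM.
  rewrite ge0_integralZl//; last 3 first.
  - exact/measurable_EFinP/measurable_funTS.
  - by move=> t _; rewrite lee_fin powR_ge0.
  - by rewrite lee_fin powR_ge0.
  rewrite (_ : (\int[_]_(_ in _) _)%E =
      \int[lambda]_(t in [set` i]) ((e + f t) `^ (- c))%:E)%E.
    by rewrite int_f -EFinM lee_fin HK.
  by apply: eq_integral => t /[!inE]/= it; rewrite fE.
apply: (@le_trans _ _ (K%:E + K%:E)%E) => //; rewrite leeD//.
  apply: (half _ (fun t => x - t)); last exact: integral_powR_left.
  by move=> t; rewrite in_itv/= => /andP[_ tx]; rewrite ger0_norm// subr_ge0.
apply: (half _ (fun t => t - x)); last exact: integral_powR_right.
by move=> t; rewrite in_itv/= => /andP[xt _]; rewrite distrC ger0_norm// subr_ge0.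
Qed.

End power_integral.

(** * Cubes, and the measure of Euclidean balls *)

Section cubes.
Context {R : realType} {n : nat}.
Local Notation mu := (lebesgue_measure_n R n).
Local Open Scope ereal_scope.

(** The closed ball of the sup norm, of side 2e. Its indicator factors over the coordinates, as
    [integral_prod_tnth] requires. *)
Definition cube (x : euclid R n) (e : R) : set (euclid R n) :=
  [set y | forall i, (`|tnth x i - tnth y i| <= e)%R].

Lemma indic_cube (x y : euclid R n) (e : R) :
  \1_(cube x e) y =
    (\prod_(i < n) \1_(`[tnth x i - e, tnth x i + e]%classic) (tnth y i : R))%R :> R.
Proof.
have tnthP i : ((tnth y i : R) \in `[(tnth x i - e)%R, (tnth x i + e)%R]%classic) =
    (`|tnth x i - tnth y i| <= e)%R.
  by rewrite mem_setE in_itv/= distrC ler_distl.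
under eq_bigr => i _ do rewrite indicE tnthP.
rewrite indicE; have [yx|yx] := boolP (y \in cube x e).
  by rewrite big1// => i _; rewrite (set_mem yx i).
have /existsNP[i /negP/negbTE yi] : ~ cube x e y by move=> /mem_set; apply/negP.
by rewrite (bigD1 i)//= yi mul0r.
Qed.

Lemma measurable_cube (x : euclid R n) (e : R) : measurable (cube x e).
Proof.
apply/(@measurable_indicP _ _ R).
rewrite (_ : \1_(cube x e) = fun y : euclid R n =>
    (\prod_(i < n) \1_(`[(tnth x i - e)%R, (tnth x i + e)%R]%classic) (tnth y i : R))%R :> R).
  apply: measurable_prod => i _; apply: measurableT_comp; last exact: measurable_tnth.
  exact: measurable_indic.
by apply/funext => y; exact: indic_cube.
Qed.

Lemma lebesgue_measure_cube (x : euclid R n) (e : R) : (0 <= e)%R ->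
  mu (cube x e) = ((2 * e) ^+ n)%:E.
Proof.
move=> e0; rewrite -(setIT (cube x e)) -integral_indic//; last exact: measurable_cube.
under eq_integral => y _ do rewrite indic_cube.
rewrite (integral_prod_tnth n (fun i => \1_(`[(tnth x i - e)%R, (tnth x i + e)%R]%classic))
  (fun=> (2 * e)%R))//.
  by rewrite prodr_const card_ord.
move=> i; rewrite integral_indic// setIT.
transitivity (lebesgue_measure (`[(tnth x i - e)%R, (tnth x i + e)%R]%classic : set R)).
  by [].
rewrite lebesgue_measure_itv/= lte_fin.
have [//|] := ltP (tnth x i - e)%R (tnth x i + e)%R => h.
  by rewrite -EFinD; congr (_%:E); ring.
by congr (_%:E); lra.
Qed.

Lemma coord_le_dist (x y : euclid R n) (i : 'I_n) :
  (`|tnth x i - tnth y i| <= euclid_dist x y)%R.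
Proof.
rewrite /euclid_dist -sqrtr_sqr ler_wsqrtr//.
by rewrite (bigD1 i)//= lerDl sumr_ge0// => j _; exact: sqr_ge0.
Qed.

Lemma ball_sub_cube (x : euclid R n) (rho : R) : euclid_ball x rho `<=` cube x rho.
Proof. by move=> y /ltW xy i; exact: le_trans (coord_le_dist x y i) xy. Qed.

(** The n squares add up to at most n (rho/(n+1))^2, and n < (n+1)^2. This inner cube is what gives
    balls positive measure. *)
Lemma cube_sub_ball (x : euclid R n) (rho : R) : (0 < rho)%R ->
  cube x (rho / n.+1%:R) `<=` euclid_ball x rho.
Proof.
move=> rho0 y xy; rewrite /euclid_ball/= /euclid_dist.
rewrite -(gtr0_norm rho0) -sqrtr_sqr ltr_sqrt ?exprn_gt0//.
apply: (@le_lt_trans _ _ (\sum_(i < n) (rho / n.+1%:R) ^+ 2)%R).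
  apply: ler_sum => i _; rewrite -[leLHS]real_normK ?num_real//.
  by rewrite ler_pXn2r ?nnegrE ?divr_ge0 ?(ltW rho0).
rewrite sumr_const card_ord -[ltLHS]mulr_natl expr_div_n mulrCA gtr_pMr ?exprn_gt0//.
rewrite ltr_pdivrMr ?exprn_gt0// mul1r -natrX ltr_nat.
by rewrite expnS expn1 (leq_trans (ltnSn n))// leq_pmulr.
Qed.

Lemma measurable_dist (x : euclid R n) : measurable_fun setT (euclid_dist x).
Proof.
apply: (measurableT_comp (continuous_measurable_fun (@sqrt_continuous R))).
apply: measurable_sum => i; apply: measurable_funX.
apply: measurable_funB => //; exact: measurable_tnth.
Qed.

Lemma measurable_euclid_ball (x : euclid R n) (rho : R) :
  measurable (euclid_ball x rho).
Proof.
have := measurable_dist x measurableT `]-oo, rho[%classic (measurable_itv _).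
by rewrite setTI; congr (measurable _).
Qed.

Lemma lebesgue_measure_ball_gt0 (x : euclid R n) (rho : R) :
  (0 < rho)%R -> 0 < mu (euclid_ball x rho).
Proof.
move=> rho0; apply: (@lt_le_trans _ _ (mu (cube x (rho / n.+1%:R)))).
  rewrite lebesgue_measure_cube ?divr_ge0 ?(ltW rho0)//.
  by rewrite lte_fin exprn_gt0// mulr_gt0// divr_gt0.
apply: le_measure; rewrite ?inE; [exact: measurable_cube|exact: measurable_euclid_ball|].
exact: cube_sub_ball.
Qed.

Lemma lebesgue_measure_ball_lty (x : euclid R n) (rho : R) :
  mu (euclid_ball x rho) < +oo.
Proof.
(* The absolute value is there because rho may be negative, while the volume formula for cubes needs
   a nonnegative half-side. *)
apply: (@le_lt_trans _ _ (mu (cube x `|rho|%R))); last first.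
  by rewrite lebesgue_measure_cube// ltry.
apply: le_measure; rewrite ?inE; [exact: measurable_euclid_ball|exact: measurable_cube|].
apply: (subset_trans (@ball_sub_cube x rho)) => y xy i.
exact: le_trans (xy i) (ler_norm _).
Qed.

Lemma ball_size_gt0 (x : euclid R n) (rho : R) : (0 < rho)%R -> (0 < ball_size x rho)%R.
Proof.
move=> rho0; rewrite powR_gt0// fine_gt0// lebesgue_measure_ball_gt0//.
exact: lebesgue_measure_ball_lty.
Qed.

End cubes.

(** * Domination of the kernel by a product, and its integral over a unit cube *)

Section kernel_bound.
Context {R : realType} (n : nat).
Local Notation mu := (lebesgue_measure_n R n).

(** The summand 1 makes each factor at least 1, so that one product also covers the case where the
    kernel is merely at most 1. The indicator confines the singular term to the interval treated by
    [integral_powR_le]. *)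
Definition coord_kernel (a c e x t : R) : R :=
  1 + \1_(`[x - 1, x + 1]%classic) t * (e `^ a * (e + `|x - t|) `^ (- c)).

Lemma coord_kernel_ge1 (a c e x t : R) : 1 <= coord_kernel a c e x t.
Proof. by rewrite lerDl mulr_ge0// mulr_ge0 ?powR_ge0. Qed.

(** The minimum with 1 keeps the parameter in the range of [integral_powR_le]; it differs from e
    only for e > 1, where the summands 1 already suffice. *)
Lemma kernel_le_prod (p q c e : R) (x y : euclid R n) : (0 < n)%N ->
    0 < e -> 0 <= q <= p -> p / n%:R <= c ->
  e `^ q * (e + euclid_dist x y) `^ (- p) <=
    \prod_(i < n) coord_kernel (q / n%:R) c (Num.min e 1) (tnth x i) (tnth y i).
Proof.
move=> n0 e0 /andP[q0 qp] pc.
have d0 : 0 <= euclid_dist x y by exact: sqrtr_ge0.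
set d := euclid_dist x y in d0 *.
have n_gt0 : 0 < n%:R :> R by rewrite ltr0n.
have ed0 : 0 < e + d by rewrite ltr_wpDr.
have [ed1|ed1] := lerP 1 (e + d).
  apply: (@le_trans _ _ 1); last first.
    apply: (@le_trans _ _ (\prod_(i < n) 1)); first by rewrite big1.
    by apply: ler_prod => i _; rewrite ler01 coord_kernel_ge1.
  apply: (@le_trans _ _ ((e + d) `^ q * (e + d) `^ (- p))).
    by rewrite ler_wpM2r ?powR_ge0// ge0_ler_powR// ?nnegrE ?(ltW e0) ?(ltW ed0)// lerDl.
  rewrite -powRD; last by rewrite (gt_eqF ed0) implybT.
  by rewrite -[leRHS](powRr0 (e + d)) ler_powR// subr_le0.
have e1 : e <= 1 by lra.
rewrite (min_idPl e1).
(* Each coordinate receives the n-th root of the kernel. *)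
have -> : e `^ q * (e + d) `^ (- p) =
    \prod_(i < n) (e `^ (q / n%:R) * (e + d) `^ (- (p / n%:R))).
  rewrite prodr_const card_ord exprMn -!powR_mulrn ?powR_ge0// -!powRrM mulNr.
  by rewrite !divfK// gt_eqF.
apply: ler_prod => i _; rewrite mulr_ge0 ?powR_ge0//=.
have ud : `|tnth x i - tnth y i| <= d := coord_le_dist x y i.
set u := `|_| in ud *.
have u0 : 0 <= u by exact: normr_ge0.
rewrite /coord_kernel indicE mem_setE in_itv/=.
have -> : tnth x i - 1 <= tnth y i <= tnth x i + 1.
  by rewrite -ler_distl distrC -/u; lra.
rewrite mul1r -[leLHS]add0r lerD// ler_wpM2l ?powR_ge0//.
(* First the exponent moves from -p/n to -c, the base being less than 1; then the base decreases
   from e + d to e + u under the exponent -c <= 0. *)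
apply: (@le_trans _ _ ((e + d) `^ (- c))).
  by rewrite ger_powR ?ed0 ?(ltW ed1)// lerN2.
rewrite !powRN lef_pV2 ?posrE ?powR_gt0//; last by rewrite ltr_wpDr.
rewrite ge0_ler_powR// ?nnegrE.
- by apply: le_trans pc; rewrite divr_ge0 ?ler0n// (le_trans q0).
- by rewrite addr_ge0 ?(ltW e0).
- exact: ltW.
- by rewrite lerD2l.
Qed.

Lemma integral_kernel_le (p q : R) (z : euclid R n) : (0 < n)%N ->
    0 <= q <= p -> p - q <= n%:R -> (q = 0 -> p < n%:R) ->
  exists2 K : R, 0 <= K & forall (e : R) (x : euclid R n), 0 < e ->
    (\int[mu]_y (\1_(cube z 2^-1) y *
      (e `^ q * (e + euclid_dist x y) `^ (- p)))%:E <= K%:E)%E.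
Proof.
move=> n0 /[dup] qp /andP[q0 qp'] pqn pn.
have n_gt0 : 0 < n%:R :> R by rewrite ltr0n.
have [c ac pc] : exists2 c : R, (0 < q / n%:R /\ c = 1 + q / n%:R) \/
    (q / n%:R = 0 /\ c < 1) & p / n%:R <= c.
  have [q00|qn0] := eqVneq q 0.
    exists (p / n%:R) => //; right; rewrite q00 mul0r; split => //.
    by rewrite ltr_pdivrMr// mul1r pn.
  exists (1 + q / n%:R); first by left; split => //; rewrite divr_gt0// lt0r qn0.
  by rewrite ler_pdivrMr// mulrDl mul1r divfK ?gt_eqF// -lerBlDr.
have [K K0 HK] := integral_powR_le _ _ ac.
(* Per coordinate, the summand 1 integrates to 1 over a side of the unit cube, and the singular term
   to at most K. *)
exists ((1 + K) ^+ n) => [|e x e0]; first by rewrite exprn_ge0// addr_ge0.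
set e' := Num.min e 1.
have e'01 : 0 < e' <= 1 by rewrite lt_min e0 ltr01 ge_min lexx orbT.
pose I (i : 'I_n) : set R := `[tnth z i - 2^-1, tnth z i + 2^-1]%classic.
have mI i : measurable (I i) by exact: measurable_itv.
pose f (i : 'I_n) (t : R) := \1_(I i) t * coord_kernel (q / n%:R) c e' (tnth x i) t.
have mker i : measurable_fun [set: R] (fun t : R =>
    e' `^ (q / n%:R) * (e' + `|tnth x i - t|) `^ (- c)).
  apply: measurable_funM => //; apply: (measurableT_comp (measurable_powR _)).
  apply: measurable_funD => //; apply: measurableT_comp => //.
  exact: measurable_funB.
have mf i : measurable_fun setT (f i).
  rewrite /f /coord_kernel.
  apply: measurable_funM; first exact: measurable_indic (mI i).
  apply: measurable_funD => //; apply: measurable_funM; last exact: mker.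
  exact: measurable_indic.
have f0 i t : 0 <= f i t.
  by rewrite mulr_ge0// (le_trans ler01)// coord_kernel_ge1.
have fK i : (\int[@lebesgue_measure R]_t (f i t)%:E <= (1 + K)%:E)%E.
  pose J : set R := `[tnth x i - 1, tnth x i + 1]%classic.
  have mJ : measurable J by exact: measurable_itv.
  pose ker (t : R) := e' `^ (q / n%:R) * (e' + `|tnth x i - t|) `^ (- c).
  have ker0 t : 0 <= ker t by rewrite mulr_ge0 ?powR_ge0.
  apply: (@le_trans _ _ (\int[@lebesgue_measure R]_t
      ((\1_(I i) t)%:E + (\1_J t * ker t)%:E)))%E.
    apply: ge0_le_integral => //.
    - by move=> t _; rewrite lee_fin.
    - by apply/measurable_EFinP; exact: mf.
    - apply: emeasurable_funD; apply/measurable_EFinP; first exact: measurable_indic (mI i).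
      by apply: measurable_funM; [exact: measurable_indic|exact: mker].
    - move=> t _; rewrite -EFinD lee_fin /f /coord_kernel mulrDr mulr1 lerD2l.
      by rewrite ler_piMl ?mulr_ge0 ?powR_ge0.
  rewrite ge0_integralD//; last 3 first.
  - by apply/measurable_EFinP; exact: measurable_indic (mI i).
  - by move=> t _; rewrite lee_fin mulr_ge0.
  - apply/measurable_EFinP; apply: measurable_funM; first exact: measurable_indic.
    exact: mker.
  rewrite EFinD leeD//.
    rewrite (_ : (\int[_]_x _)%E = lebesgue_measure (I i)); last first.
      by rewrite integral_indic ?setIT//; exact: mI.
    rewrite /I lebesgue_measure_itv/= lte_fin.
    by rewrite ifT -?EFinD ?lee_fin; lra.
  apply: le_trans (HK e' (tnth x i) e'01).
  rewrite [leRHS]integral_mkcond le_eqVlt; apply/orP; left; apply/eqP.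
  apply: eq_integral => t _; rewrite patchE indicE.
  by case: ifPn => tJ; rewrite ?mul1r ?mul0r.
(* [integral_prod_tnth] takes real values for the integrals, so the bound by 1 + K is first used for
   finiteness. *)
have fin i : (\int[@lebesgue_measure R]_t (f i t)%:E =
    (fine (\int[@lebesgue_measure R]_t (f i t)%:E))%:E)%E.
  rewrite fineK// ge0_fin_numE; first exact: le_lt_trans (fK i) (ltry _).
  by apply: integral_ge0 => t _; rewrite lee_fin.
have mprod : measurable_fun setT (fun y : euclid R n => \prod_(i < n) f i (tnth y i)).
  apply: measurable_prod => i _; apply: (measurableT_comp (mf i)).
  exact: measurable_tnth.
apply: (@le_trans _ _ (\int[mu]_y (\prod_(i < n) f i (tnth y i))%:E)%E).
  apply: ge0_le_integral => //.
  - by move=> y _; rewrite lee_fin mulr_ge0// mulr_ge0 ?powR_ge0.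
  - apply/measurable_EFinP; apply: measurable_funM.
      by apply: measurable_indic; exact: measurable_cube.
    apply: measurable_funM => //; apply: (measurableT_comp (measurable_powR _)).
    by apply: measurable_funD => //; exact: measurable_dist.
  - exact/measurable_EFinP.
  - move=> y _; rewrite lee_fin big_split/= indic_cube.
    by rewrite ler_wpM2l ?prodr_ge0// kernel_le_prod.
rewrite (integral_prod_tnth n f _ mf f0 fin) lee_fin.
rewrite -[n in leRHS]card_ord -prodr_const ler_prod// => i _.
by rewrite -!lee_fin -fin fK andbT integral_ge0// => t _; rewrite lee_fin.
Qed.

End kernel_bound.

(** Treats finite r and r = +oo (where t = 1) together: n/r becomes the real number n(1 - 1/t). *)
Lemma hoelder_conjugate_gt1 (R : realType) (r : \bar R) : (1 < r)%E ->
  exists t : R, [/\ 1 <= t, fine (hoelder_conjugate r) = t & r^-1%E = (1 - t^-1)%:E].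
Proof.
case: r => [r|_|//].
  rewrite lte_fin => r1; exists (r / (r - 1)).
  have r0 : r != 0 by lra.
  have r10 : r - 1 != 0 by lra.
  split.
  - by rewrite ler_pdivlMr; lra.
  - by rewrite /hoelder_conjugate/= eqe (negbTE r0) -EFinB inver (negbTE r10).
  - by rewrite inver (negbTE r0) invf_div mulrBl divff// mul1r subKr.
by exists 1; rewrite hoelder_conjugatey invey invr1 subrr.
Qed.

Lemma Lnorm_pinfty_le d (T : measurableType d) (R : realType)
    (mu : {measure set T -> \bar R}) (f : T -> \bar R) (k : R) :
  0 <= k -> (forall x, (`|f x| <= k%:E)%E) -> (Lnorm mu +oo f <= k%:E)%E.
Proof.
(* On a space of measure zero the norm is 0 by convention; there k >= 0 is what is used. *)
move=> k0 fk; rewrite unlock; case: ifPn => _; last by rewrite lee_fin.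
by apply/ess_supP; exact: nearW.
Qed.

(** * The pair made of an indicator and the constant 1 *)

Section indicator_weights.
Context {R : realType} {n : nat}.
Local Notation mu := (lebesgue_measure_n R n).
Local Open Scope ereal_scope.

Lemma lebesgue_measure_n_setT_gt0 : 0 < mu setT.
Proof.
apply: (@lt_le_trans _ _ (mu (cube [tuple of nseq n 0%R] 2^-1))).
  by rewrite lebesgue_measure_cube ?invr_ge0// divff// expr1n lte01.
by apply: le_measure; rewrite ?inE//; exact: measurable_cube.
Qed.

Lemma weight_cst1 : weight (cst 1 : euclid R n -> \bar R).
Proof.
split => [x||x rho].
- exact: lee01.
- by exists (cst 1) => //; exact: ae_eq_refl.
- rewrite integral_cst; last exact: measurable_euclid_ball.
  by rewrite mul1e; exact: lebesgue_measure_ball_lty.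
Qed.

Lemma weight_indic (A : set (euclid R n)) : measurable A -> mu A < +oo ->
  weight (fun y : euclid R n => (\1_A y)%:E).
Proof.
move=> mA Afin; split => [x||x rho].
- by rewrite lee_fin.
- exists (fun y : euclid R n => (\1_A y)%:E); last exact: ae_eq_refl.
  by apply/measurable_EFinP; exact: measurable_indic.
- rewrite integral_indic//; last exact: measurable_euclid_ball.
  apply: le_lt_trans Afin; apply: le_measure; rewrite ?inE//.
  by apply: measurableI => //; exact: measurable_euclid_ball.
Qed.

Lemma nontrivial_indic (A : set (euclid R n)) : measurable A -> 0 < mu A ->
  ~ trivial_pair (fun y : euclid R n => (\1_A y)%:E) (cst 1).
Proof.
move=> mA A0 [[N [mN N0 AN]]|[N [mN N0 AN]]].
  have : mu A <= mu N.
    apply: le_measure; rewrite ?inE// => y Ay; apply: AN => /= /(_ I).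
    by rewrite indicE mem_set//= => -[] /eqP; rewrite oner_eq0.
  by rewrite N0 leNgt A0.
have : mu setT <= mu N.
  by apply: le_measure; rewrite ?inE// => y _; apply: AN => /= /(_ I).
by rewrite N0 leNgt lebesgue_measure_n_setT_gt0.
Qed.

(** An indicator is unchanged by a positive power, and the base is positive, so the inverse in
    [\bar R] is a real negative power. *)
Lemma bbH_tail_indic (A : set (euclid R n)) (r : \bar R) (t delta talpha : R)
    (x : euclid R n) (rho : R) :
  (0 < rho)%R -> 1 < r -> (1 <= t)%R -> fine (hoelder_conjugate r) = t ->
  bbH_tail r delta talpha (fun y => (\1_A y)%:E) x rho =
  (\int[mu]_y (\1_A y * (ball_size x rho + euclid_dist x y) `^
     (- (t * (n%:R - talpha + delta))))%:E) `^ t^-1.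
Proof.
move=> rho0 r1 t1 rt; rewrite /bbH_tail gt_eqF// rt.
congr (_ `^ _); apply: eq_integral => y _.
have d0 : (0 < ball_size x rho + euclid_dist x y)%R.
  by rewrite ltr_wpDr ?ball_size_gt0// sqrtr_ge0.
rewrite inver gt_eqF ?powR_gt0// poweR_EFin -EFinM powRN; congr ((_ * _)%:E).
rewrite indicE; case: (_ \in _) => /=; first by rewrite powR1.
by rewrite powR0// gt_eqF// (lt_le_trans ltr01).
Qed.

End indicator_weights.

(** * Uniform bound over all balls, for [r = 1] and then for [1 < r] *)

Theorem theorem3p6 (R : realType) (n m : nat) (gamma alpha delta : R)
    (n_ge1 : (1 <= n)%N) (gamma_gt0 : 0 < gamma) (gamma_le1 : gamma <= 1)
    (alpha_ge0 : 0 <= alpha) (alpha_ltn : alpha < n%:R)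
    (delta_gt0 : 0 < delta)
    (delta_lt : (delta%:E < mine gamma%:E ((n%:R - alpha)%:E / m%:R%:E))%E) :
  let talpha := m%:R * delta + alpha in
  forall (r : \bar R) (tdelta : R),
    (1 <= r)%E ->
    talpha - n%:R <= tdelta ->
    (tdelta%:E <= mine delta%:E (talpha%:E - n%:R%:E / r))%E ->
    ~ (tdelta = delta /\ (talpha%:E - n%:R%:E / r = delta%:E)%E) ->
  exists v w : euclid R n -> \bar R,
    [/\ weight v, weight w, ~ trivial_pair v w
      & bbH r delta talpha tdelta v w].
Proof.
move=> talpha r tdelta r1 tdelta_ge tdelta_le tdelta_ne.
have {tdelta_le}[tdelta_le tdelta_le'] :
    (tdelta <= delta) /\ (tdelta%:E <= talpha%:E - n%:R%:E / r)%E.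
  by move: tdelta_le; rewrite le_min lee_fin => /andP[].
pose Q : set (euclid R n) := cube [tuple of nseq n (0 : R)] 2^-1.
have mQ : measurable Q by exact: measurable_cube.
have muQ : lebesgue_measure_n R n Q = 1%E.
  by rewrite lebesgue_measure_cube ?invr_ge0// divff// expr1n.
exists (fun y => (\1_Q y)%:E), (cst 1%E); split.
- by apply: weight_indic => //; rewrite muQ ltry.
- exact: weight_cst1.
- by apply: nontrivial_indic => //; rewrite muQ lte01.
have n_gt0 : 0 < n%:R :> R by rewrite ltr0n.
have size_pow x rho :
    fine (lebesgue_measure_n R n (euclid_ball x rho)) `^ ((delta - tdelta) / n%:R) =
    (ball_size x rho) `^ (delta - tdelta).
  by rewrite /ball_size -powRrM mulrC.
have w_le1 (x : euclid R n) rho : (Lnorm (lebesgue_measure_n R n) +oo (fun y : euclid R n =>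
    (cst 1 y)^-1 * (\1_(euclid_ball x rho) y)%:E) <= 1)%E.
  apply: Lnorm_pinfty_le => // y; rewrite /= inve1 mul1e lee_fin ger0_norm//.
suff [K HK] : exists K : R, forall (x : euclid R n) (rho : R), 0 < rho ->
    (((ball_size x rho) `^ (delta - tdelta))%:E *
      bbH_tail r delta talpha (fun y => (\1_Q y)%:E) x rho <= K%:E)%E.
  apply: le_lt_trans (ltry K); apply: ub_ereal_sup => _ [x [rho [rho0 ->]]].
  rewrite /bbH_quantity size_pow -muleA -[leRHS]mul1e.
  apply: lee_pmul => //; first exact: Lnorm_ge0.
    rewrite mule_ge0 ?lee_fin ?powR_ge0// /bbH_tail.
    by case: ifP => _; [exact: Lnorm_ge0|exact: poweR_ge0].
  exact: HK.
set s := n%:R - talpha + delta.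
have [r_eq1|r_ne1] := eqVneq r 1%E.
  exists 1 => x rho rho0; set e := ball_size x rho.
  have e0 : 0 < e by exact: ball_size_gt0.
  (* At r = 1 the two bounds on [tdelta] meet at [talpha - n]. *)
  have -> : delta - tdelta = s.
    move: tdelta_le'; rewrite r_eq1 inve1 mule1 lee_fin /s => ?; lra.
  have s0 : 0 <= s by rewrite /s; lra.
  have es0 : 0 < e `^ s by exact: powR_gt0.
  apply: (@le_trans _ _ ((e `^ s)%:E * (e `^ (- s))%:E)%E); last first.
    by rewrite -EFinM powRN divff// gt_eqF.
  rewrite lee_pmul2l// /bbH_tail r_eq1 eqxx.
  apply: Lnorm_pinfty_le; first exact: powR_ge0.
  move=> y; rewrite -EFinM abse_EFin lee_fin ger0_norm ?mulr_ge0 ?powR_ge0//.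
  have ed : e <= e + euclid_dist x y by rewrite lerDl sqrtr_ge0.
  rewrite -[leRHS]mul1r ler_pM ?powR_ge0//.
  have ed0 : 0 < e + euclid_dist x y := lt_le_trans e0 ed.
  rewrite !powRN lef_pV2 ?posrE; [|exact: powR_gt0|exact: powR_gt0].
  by rewrite ge0_ler_powR// ?nnegrE ltW.
have {r1}r1 : (1 < r)%E by rewrite lt_def r_ne1.
have [t [t1 rt rV]] := hoelder_conjugate_gt1 _ _ r1.
have t0 : 0 < t by exact: lt_le_trans t1.
move: tdelta_le' tdelta_ne; rewrite rV -EFinM -EFinB lee_fin => tdelta_le' tdelta_ne.
have [K K0 HK] : exists2 K : R, 0 <= K & forall (e : R) (x : euclid R n), 0 < e ->
    (\int[lebesgue_measure_n R n]_y (\1_Q y *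
      (e `^ (t * (delta - tdelta)) * (e + euclid_dist x y) `^ (- (t * s))))%:E <= K%:E)%E.
  apply: integral_kernel_le => //.
  - rewrite mulr_ge0 ?(ltW t0) ?subr_ge0//= ler_pM2l// /s; lra.
  (* Here p - q = t(n - talpha + tdelta), and the upper bound reads tdelta <= talpha - n + n/t. *)
  - rewrite -mulrBr -ler_pdivlMl// mulrC.
    rewrite mulrBr mulr1 in tdelta_le'; rewrite /s; lra.
  (* q = 0 means [tdelta = delta]; then p = n would give talpha - n/r = delta, the excluded case. *)
  - move=> /eqP; rewrite mulf_eq0 gt_eqF//= subr_eq0 => /eqP dt.
    rewrite -ltr_pdivlMl// mulrC lt_neqAle; apply/andP; split; last first.
      rewrite mulrBr mulr1 in tdelta_le'; rewrite /s; lra.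
    apply/eqP => sE; apply: tdelta_ne; split => //.
    by congr (_%:E); rewrite mulrBr mulr1 -sE /s; lra.
exists (K `^ t^-1) => x rho rho0.
have e0 := ball_size_gt0 x rho rho0.
rewrite (bbH_tail_indic _ _ t)//; set e := ball_size x rho in e0 *.
(* Writing the factor as a t-th root lets it enter the integral as e^q. *)
have -> : (e `^ (delta - tdelta))%:E = ((e `^ (t * (delta - tdelta)))%:E `^ t^-1)%E.
  by rewrite poweR_EFin -powRrM mulrAC divff ?mul1r ?gt_eqF.
have int_ge0 : (0 <= \int[lebesgue_measure_n R n]_y (\1_Q y *
    (e + euclid_dist x y) `^ (- (t * s)))%:E)%E.
  by apply: integral_ge0 => y _; rewrite lee_fin mulr_ge0 ?powR_ge0.
rewrite -poweRM ?lee_fin ?powR_ge0// -[leRHS]poweR_EFin gt0_ler_poweR//.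
- by rewrite invr_ge0 ltW.
- by rewrite in_itv/= leey andbT mule_ge0 ?lee_fin ?powR_ge0.
- by rewrite in_itv/= leey andbT lee_fin.
rewrite -ge0_integralZl//.
- apply: le_trans (HK e x e0); rewrite le_eqVlt; apply/orP; left; apply/eqP.
  by apply: eq_integral => y _; rewrite -EFinM mulrCA.
- apply/measurable_EFinP; apply: measurable_funM; first exact: measurable_indic.
  apply: (measurableT_comp (measurable_powR _)).
  by apply: measurable_funD => //; exact: measurable_dist.
- by move=> y _; rewrite lee_fin mulr_ge0 ?powR_ge0.
- by rewrite lee_fin powR_ge0.
Qed.
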